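(* Let $(M,g)$ be a connected real analytic Riemannian manifold with Levi-Civita connection $\nabla$, let $J\subset\mathbb{R}$ be an open interval with $0\in J$, let $\gamma:J\to M$ be a geodesic with unit initial vector $\gamma'(0)$, and let $X$ be a differentiable vector field along $\gamma$. Then for every integer $n\ge 1$ and every $t\in J$, $$\nabla_{\gamma'}^{\,n}\bigl(R(X,\gamma')\gamma'\bigr)(t)=\sum_{i=0}^{n}\binom{n}{i}\,R^{n-i)}_t\bigl((\nabla_{\gamma'}^{\,i}X)(t)\bigr).$$
   Context: $R$ is the curvature tensor of $\nabla$, with the Kobayashi-Nomizu convention $R(X,Y)Z=\nabla_X\nabla_YZ-\nabla_Y\nabla_XZ-\nabla_{[X,Y]}Z$. The Jacobi operator along $\gamma$ is the self-adjoint tensor field $R_t=R(\cdot,\gamma')\gamma'(t)$. Its $i$-th covariant derivative along $\gamma$ is $R^{i)}_t=(\nabla_{\gamma'}\cdots\nabla_{\gamma'}R)(\cdot,\gamma')\gamma'(t)$, with $i$ covariant derivatives of the tensor $R$, and $R^{0)}_t=R_t$. $\nabla_{\gamma'}^{\,i}$ denotes $i$-fold covariant differentiation along $\gamma$ (with $\nabla^{\,0}_{\gamma'}X=X$). ''Differentiable'' means $C^\infty$. *)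

(* Defs.v *)
From mathcomp Require Import all_boot all_order all_algebra.
From mathcomp Require Import finmap.
From mathcomp Require Import all_classical all_reals all_analysis.

Set Implicit Arguments.
Unset Strict Implicit.
Unset Printing Implicit Defensive.

Import Order.TTheory GRing.Theory Num.Theory.
Import numFieldNormedType.Exports.

Local Open Scope classical_set_scope.
Local Open Scope ring_scope.

(* [l] is the sum of the unordered (hence absolutely convergent) family [u]. *)
Definition has_sum (R : realType) (I : choiceType) (u : I -> R) (l : R) :=
  forall e : R, 0 < e -> exists F0 : {fset I}, forall F : {fset I},
    (F0 `<=` F)%fset -> `|\sum_(a <- F) u a - l| < e.

(* [f] is near [x] the sum of a convergent power series in m variables, indexed
   by multi-indices; balls of ['rV_m] are polydiscs (sup norm). *)
Definition analytic_at (R : realType) (m : nat) (f : 'rV[R]_m -> R)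
    (x : 'rV[R]_m) :=
  exists (c : {ffun 'I_m -> nat} -> R) (r : R), 0 < r /\
    forall y, ball x r y ->
      has_sum (fun a : {ffun 'I_m -> nat} =>
                 c a * \prod_(k < m) (y 0 k - x 0 k) ^+ a k) (f y).

Definition analytic_on (R : realType) (m : nat) (U : set 'rV[R]_m)
    (f : 'rV[R]_m -> R) :=
  forall x, U x -> analytic_at f x.

(* D_(k1) (D_(k2) (... F)) for s = [:: k1; k2; ...] *)
Definition iter_partial (R : realType) (m : nat) (V : normedModType R)
    (F : 'rV[R]_m -> V) (s : seq 'I_m) : 'rV[R]_m -> V :=
  foldr (fun (k : 'I_m) (G : 'rV[R]_m -> V) x => 'D_(delta_mx 0 k) G x) F s.

(* C^infinity, meant for an open set U *)
Definition smooth_on (R : realType) (m : nat) (V : normedModType R)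
    (U : set 'rV[R]_m) (F : 'rV[R]_m -> V) :=
  forall (s : seq 'I_m) x, U x -> differentiable (iter_partial F s) x.

Definition smooth1_on (R : realType) (V : normedModType R)
    (U : set R) (f : R -> V) :=
  forall (k : nat) t, U t -> derivable (derive1n k f) t 1.

Record analytic_manifold (R : realType) (m : nat) := AnalyticManifold {
  carrier :> topologicalType ;
  chart : Type ;
  dom : chart -> set carrier ;
  coord : chart -> carrier -> 'rV[R]_m ;
  param : chart -> 'rV[R]_m -> carrier ;
  manifold_hausdorff : hausdorff_space carrier ;
  manifold_second_countable : @second_countable carrier ;
  dom_cover : forall p, exists i, dom i p ;
  dom_open : forall i, open (dom i) ;
  codom_open : forall i, open (coord i @` dom i) ;
  coordK : forall i p, dom i p -> param i (coord i p) = p ;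
  coord_continuous : forall i p, dom i p -> {for p, continuous (coord i)} ;
  param_continuous : forall i x, (coord i @` dom i) x ->
    {for x, continuous (param i)} ;
  transition_analytic : forall i j (k : 'I_m),
    analytic_on (coord i @` (dom i `&` dom j))
                (fun x => coord j (param i x) 0 k) }.

Definition codom (R : realType) (m : nat) (M : analytic_manifold R m)
    (i : chart M) : set 'rV[R]_m := coord i @` dom i.

(* A tangent vector at p is given by its components in all the charts around p,
   related by the differentials of the transition maps ([is_tangent]).  The
   components in charts whose domain does not contain p are irrelevant, so that
   tangent vectors at p are compared by [eq_at p].  Every operation below that
   yields a [tvec] computes its i-th component from i-th components only. *)
Definition tvec (R : realType) (m : nat) (M : analytic_manifold R m) : Type :=
  chart M -> 'rV[R]_m.

Definition is_tangent (R : realType) (m : nat) (M : analytic_manifold R m)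
    (p : M) (v : tvec M) :=
  forall i j, dom i p -> dom j p ->
    v j = 'D_(v i) (fun x => coord j (param i x)) (coord i p).

Definition eq_at (R : realType) (m : nat) (M : analytic_manifold R m)
    (p : M) (u v : tvec M) :=
  forall i, dom i p -> u i = v i.

Notation "u =_[ p ] v" := (eq_at p u v)
  (at level 70, p at level 50, no associativity, format "u  =_[ p ]  v").

Definition vfield (R : realType) (m : nat) (M : analytic_manifold R m) : Type :=
  M -> tvec M.

Definition local_rep (R : realType) (m : nat) (M : analytic_manifold R m)
    (X : vfield M) (i : chart M) : 'rV[R]_m -> 'rV[R]_m :=
  fun x => X (param i x) i.

Definition is_vfield (R : realType) (m : nat) (M : analytic_manifold R m)
    (X : vfield M) :=
  (forall p, is_tangent p (X p)) /\
  (forall i, smooth_on (codom i) (local_rep X i)).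

Definition bracket (R : realType) (m : nat) (M : analytic_manifold R m)
    (X Y : vfield M) : vfield M := fun p i =>
  'D_(X p i) (local_rep Y i) (coord i p) -
  'D_(Y p i) (local_rep X i) (coord i p).

Definition chart_inner (R : realType) (m : nat) (G : 'M[R]_m)
    (u v : 'rV[R]_m) : R := (u *m G *m v^T) 0 0.

(* [gram i p] is the Gram matrix at p of the coordinate frame of the chart i. *)
Record metric (R : realType) (m : nat) (M : analytic_manifold R m) := Metric {
  gram : chart M -> M -> 'M[R]_m ;
  gram_sym : forall i p, dom i p -> (gram i p)^T = gram i p ;
  gram_pos : forall i p (u : 'rV[R]_m), dom i p -> u != 0 ->
    0 < chart_inner (gram i p) u u ;
  gram_tangent : forall i j p (u v : tvec M), dom i p -> dom j p ->
    is_tangent p u -> is_tangent p v ->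
    chart_inner (gram i p) (u i) (v i) = chart_inner (gram j p) (u j) (v j) ;
  gram_analytic : forall i (a b : 'I_m),
    analytic_on (codom i) (fun x => gram i (param i x) a b) }.

Definition inner (R : realType) (m : nat) (M : analytic_manifold R m)
    (g : metric M) (i : chart M) (p : M) (u v : tvec M) : R :=
  chart_inner (gram g i p) (u i) (v i).

(* [G i x a b] lists the components of the covariant derivative of the b-th
   coordinate field along the a-th one, at the point of coordinates x. *)
Definition coefs (R : realType) (m : nat) (M : analytic_manifold R m) : Type :=
  chart M -> 'rV[R]_m -> 'I_m -> 'I_m -> 'rV[R]_m.

Definition coefs_act (R : realType) (m : nat) (M : analytic_manifold R m)
    (G : coefs M) (i : chart M) (x u v : 'rV[R]_m) : 'rV[R]_m :=
  \sum_(a < m) \sum_(b < m) (u 0 a * v 0 b) *: G i x a b.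

Definition nabla (R : realType) (m : nat) (M : analytic_manifold R m)
    (G : coefs M) (X Y : vfield M) : vfield M := fun p i =>
  'D_(X p i) (local_rep Y i) (coord i p) +
  coefs_act G i (coord i p) (X p i) (Y p i).

(* [nabla_vfield] says that the local formulas agree on overlaps. *)
Record connection (R : realType) (m : nat) (M : analytic_manifold R m) :=
  Connection {
  christoffel :> coefs M ;
  christoffel_smooth : forall i (a b : 'I_m),
    smooth_on (codom i) (fun x => christoffel i x a b) ;
  nabla_vfield : forall X Y : vfield M, is_vfield X -> is_vfield Y ->
    is_vfield (nabla christoffel X Y) }.

Definition torsion_free (R : realType) (m : nat) (M : analytic_manifold R m)
    (N : connection M) :=
  forall X Y : vfield M, is_vfield X -> is_vfield Y ->
    forall p, nabla N X Y p - nabla N Y X p =_[p] bracket X Y p.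

Definition metric_compatible (R : realType) (m : nat)
    (M : analytic_manifold R m) (g : metric M) (N : connection M) :=
  forall X Y Z : vfield M, is_vfield X -> is_vfield Y -> is_vfield Z ->
    forall p i, dom i p ->
      'D_(X p i) (fun x => let q := param i x in inner g i q (Y q) (Z q))
        (coord i p)
      = inner g i p (nabla N X Y p) (Z p) + inner g i p (Y p) (nabla N X Z p).

Definition levi_civita (R : realType) (m : nat) (M : analytic_manifold R m)
    (g : metric M) (N : connection M) :=
  torsion_free N /\ metric_compatible g N.

Definition curvature (R : realType) (m : nat) (M : analytic_manifold R m)
    (N : connection M) (X Y Z : vfield M) : vfield M :=
  nabla N X (nabla N Y Z) - nabla N Y (nabla N X Z) - nabla N (bracket X Y) Z.

(* The curvature tensor at p.  Since [curvature] is tensorial, its value at p on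
   tangent vectors u, v, w can be computed, in each chart i, with any local
   extensions of them; [fun=> u] is, in the chart i, the field with constant
   components u i. *)
Definition curv_at (R : realType) (m : nat) (M : analytic_manifold R m)
    (N : connection M) (p : M) (u v w : tvec M) : tvec M :=
  curvature N (fun=> u) (fun=> v) (fun=> w) p.

Definition velocity (R : realType) (m : nat) (M : analytic_manifold R m)
    (c : R -> M) : R -> tvec M :=
  fun t i => derive1 (fun s => coord i (c s)) t.

Definition smooth_curve (R : realType) (m : nat) (M : analytic_manifold R m)
    (J : set R) (c : R -> M) :=
  (forall t, J t -> {for t, continuous c}) /\
  (forall i, smooth1_on (J `&` c @^-1` dom i) (fun s => coord i (c s))).

Definition is_vfield_along (R : realType) (m : nat)
    (M : analytic_manifold R m) (J : set R) (c : R -> M) (X : R -> tvec M) :=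
  (forall t, J t -> is_tangent (c t) (X t)) /\
  (forall i, smooth1_on (J `&` c @^-1` dom i) (fun s => X s i)).

Definition covd (R : realType) (m : nat) (M : analytic_manifold R m)
    (N : connection M) (c : R -> M) (X : R -> tvec M) : R -> tvec M :=
  fun t i => derive1 (fun s => X s i) t +
             coefs_act N i (coord i (c t)) (velocity c t i) (X t i).

Definition geodesic (R : realType) (m : nat) (M : analytic_manifold R m)
    (N : connection M) (J : set R) (c : R -> M) :=
  smooth_curve J c /\
  (forall t, J t -> covd N c (velocity c) t =_[c t] (fun=> 0)).

Definition tensor13 (R : realType) (m : nat) (M : analytic_manifold R m) : Type :=
  R -> tvec M -> tvec M -> tvec M -> tvec M.

(* The connection induced on (1,3)-tensor fields along c:
   (DT)(U,V,W) = D(T(U,V,W)) - T(DU,V,W) - T(U,DV,W) - T(U,V,DW),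
   evaluated with the extensions [fun=> u], [fun=> v], [fun=> w] of the
   arguments (constant components in each chart). *)
Definition covd_tensor (R : realType) (m : nat) (M : analytic_manifold R m)
    (N : connection M) (c : R -> M) (T : tensor13 M) : tensor13 M :=
  fun t u v w =>
    covd N c (fun s => T s u v w) t
    - T t (covd N c (fun=> u) t) v w
    - T t u (covd N c (fun=> v) t) w
    - T t u v (covd N c (fun=> w) t).

(* R^{k)}_t, with the k covariant derivatives applied to the tensor R itself *)
Definition jacobi_op (R : realType) (m : nat) (M : analytic_manifold R m)
    (N : connection M) (c : R -> M) (k : nat) (t : R) (v : tvec M) : tvec M :=
  iter k (covd_tensor N c) (fun s => curv_at N (c s)) t
    v (velocity c t) (velocity c t).

(* Main.v *)
Require Import Defs.

From HB Require Import structures.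
From mathcomp Require Import all_boot all_order all_algebra.
From mathcomp Require Import all_classical all_reals all_analysis.
From mathcomp Require Import ring.

Set Implicit Arguments.
Unset Strict Implicit.
Unset Printing Implicit Defensive.

Import Order.TTheory GRing.Theory Num.Theory.
Import numFieldNormedType.Exports.

Local Open Scope classical_set_scope.
Local Open Scope ring_scope.

(** The identity is the n-fold Leibniz rule for the trilinear pairing of the
    curvature tensor with the fields [X], [c'] and [c']: one covariant derivative
    falls either on the tensor or on one of the three fields, and along a
    geodesic the terms where it falls on [c'] vanish.  With D for the covariant
    derivative along [c], this gives
    D (T (X, c', c')) = (DT) (X, c', c') + T (DX, c', c') for every tensor field
    T along [c], and the binomial coefficients come from Pascal's rule
    ([sum_pascal], [iter_chart_covd_leibniz]).

    Two tangent vectors at [c t] are equal when their components agree in each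
    chart around [c t], and the components of covariant derivatives and of the
    curvature in a chart depend only on the components of their arguments in
    that chart ([iter_covd_chart], [iter_covd_tensor_chart],
    [curv_at_component]).  So everything is computed in one chart, over the open
    set U of times at which the curve lies in its domain.  There D is
    [A |-> A' + G A] for a smooth family of linear maps G, and the single Leibniz
    rule ([chart_covd_leibniz]) follows from the product rule for a smooth family
    of linear maps applied to a smooth curve ([derive1_linear_family]), used once
    per slot of the tensor.

    The remaining work is regularity.  Smoothness must survive each operation,
    since the identity for n is differentiated to reach n + 1.  The curvature is
    expressed through the Christoffel symbols and their partial derivatives
    ([curv_atE]), which are smooth along the curve by the chain rule
    ([smooth1_comp]). *)

(** * Rules of derivation *)

Lemma is_derive_bigsum (R : realType) (V W : normedModType R) (I : finType)
    (x v : V) (h : I -> V -> W) (dh : I -> W) :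
  (forall i, is_derive x v (h i) (dh i)) ->
  is_derive x v (fun y => \sum_i h i y) (\sum_i dh i).
Proof.
move=> dhP; rewrite (_ : (fun _ => _) = \sum_i h i); last first.
  by apply/funext => y; rewrite fct_sumE.
elim/big_ind2 : _ => [|? ? ? ? ? ?|i _]; first exact: is_derive_cst.
  exact: is_deriveD.
exact: dhP.
Qed.

Lemma is_derive_scale (R : realType) (V W : normedModType R) (x v : V)
    (f : V -> R) (g : V -> W) (df : R) (dg : W) :
  is_derive x v f df -> is_derive x v g dg ->
  is_derive x v (fun y => f y *: g y) (df *: g x + f x *: dg).
Proof.
move=> [fd <-] [gd <-].
suff H : (fun h => h^-1 *: (((fun y => f y *: g y) \o shift x) (h *: v)
    - f x *: g x)) @ 0^' --> 'D_v f x *: g x + f x *: 'D_v g x.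
  by apply: DeriveDef; [apply/cvg_ex; eexists; exact: H|exact: cvg_lim H].
rewrite [X in X @ _](_ : _ = fun h =>
    (h^-1 *: (f (h *: v + x) - f x)) *: g x +
    f (h *: v + x) *: (h^-1 *: (g (h *: v + x) - g x))); last first.
  apply/funext => h /=.
  transitivity (h^-1 *: ((f (h *: v + x) - f x) *: g x +
      f (h *: v + x) *: (g (h *: v + x) - g x))).
    by congr (_ *: _); rewrite scalerBr scalerBl [RHS]addrC subrKA.
  by rewrite scalerDr !scalerA [f (h *: v + x) * _]mulrC.
apply: cvgD; first by apply: cvgZr_tmp; exact: fd.
apply: cvgZ; last exact: gd.
have : {for 0, continuous (fun h : R => f (h *: v + x))}.
  exact/differentiable_continuous/derivable1_diffP/(derivable1P _ _ _).1.
by move=> /continuous_withinNx; rewrite scale0r add0r.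
Qed.

Lemma is_derive1 (R : realType) (V : normedModType R) (f : R -> V) (t : R) :
  derivable f t 1 -> is_derive t 1 f (derive1 f t).
Proof. by move=> fd; rewrite derive1E; exact: derivableP. Qed.

Lemma is_derive1_val (R : realType) (V : normedModType R) (f : R -> V) (t : R)
    (df : V) :
  is_derive t 1 f df -> derive1 f t = df.
Proof. by move=> [_ <-]; rewrite derive1E. Qed.

Lemma is_derive1_comp (R : realType) (V W : normedModType R) (x : R -> V)
    (F : V -> W) (t : R) :
  derivable x t 1 -> differentiable F (x t) ->
  is_derive t 1 (F \o x) ('D_(derive1 x t) F (x t)).
Proof.
move=> /derivable1_diffP xd Fd; have cd := differentiable_comp xd Fd.
apply: DeriveDef; first exact/derivable1_diffP.
by rewrite !deriveE// diff_comp// derive1E'.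
Qed.

Lemma derive_linear_dir (R : realType) (V W : normedModType R) (F : V -> W) x :
  differentiable F x -> linear (fun u => 'D_u F x).
Proof. by move=> Fd a u v; rewrite !deriveE// linearP. Qed.

Lemma smooth_on_partial (R : realType) (m : nat) (V : normedModType R)
    (D : set 'rV[R]_m) (F : 'rV[R]_m -> V) (k : 'I_m) :
  smooth_on D F -> smooth_on D ('D_(delta_mx 0 k) F).
Proof.
by move=> Fs s y Dy; have := Fs (rcons s k) y Dy; rewrite /iter_partial foldr_rcons.
Qed.

(** * Calculus of smooth functions of one variable *)

Section Smooth1.
Variables (R : realType) (U : set R) (U_open : open U).
Implicit Types V W : normedModType R.

Definition derivable_upto V n (f : R -> V) :=
  forall k, (k <= n)%N -> forall t, U t -> derivable (derive1n k f) t 1.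

Lemma smooth1P V (f : R -> V) :
  smooth1_on U f <-> forall n, derivable_upto n f.
Proof. by split=> [fs n k _|fs k]; [exact: fs|exact: (fs k)]. Qed.

Lemma derivable_uptoS V n (f : R -> V) :
  derivable_upto n.+1 f <->
  (forall t, U t -> derivable f t 1) /\ derivable_upto n (derive1 f).
Proof.
split=> [fs|[fd fs] [_|k kn] t Ut]; last 2 first.
- exact: fd.
- by rewrite derive1Sn; exact: fs.
by split=> [t|k kn t] Ut; [exact: (fs 0)|rewrite -derive1Sn; exact: fs].
Qed.

Lemma derivable_uptoW V n (f : R -> V) :
  derivable_upto n.+1 f -> derivable_upto n f.
Proof. by move=> fs k kn; apply: fs; exact: leqW. Qed.

Lemma derivable_upto1 V n (f : R -> V) :
  derivable_upto n f -> forall t, U t -> derivable f t 1.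
Proof. by move=> /(_ 0); exact. Qed.

Lemma near_eq_on V (f g : R -> V) t : {in U, f =1 g} -> U t ->
  \forall s \near t, f s = g s.
Proof.
move=> fg Ut; apply: filterS (open_nbhs_nbhs (conj U_open Ut)) => s Us.
by apply: fg; rewrite inE.
Qed.

Lemma eq_on_derive1 V (f g : R -> V) : {in U, f =1 g} ->
  {in U, derive1 f =1 derive1 g}.
Proof.
move=> fg t; rewrite inE => Ut; rewrite !derive1E.
by apply: near_eq_derive; exact: near_eq_on.
Qed.

Lemma eq_on_derivable_upto V n (f g : R -> V) : {in U, f =1 g} ->
  derivable_upto n f -> derivable_upto n g.
Proof.
move=> fg fs k kn t Ut; apply: near_eq_derivable (fs k kn t Ut).
apply: near_eq_on Ut; elim: k {kn} => [//|k IHk].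
by rewrite !derive1nS; exact: eq_on_derive1.
Qed.

Lemma eq_on_smooth1 V (f g : R -> V) : {in U, f =1 g} ->
  smooth1_on U f -> smooth1_on U g.
Proof.
move=> fg /smooth1P fs; apply/smooth1P => n; exact: eq_on_derivable_upto (fs n).
Qed.

(** A function is smooth as soon as its derivative at each point of [U] has
    been computed and is again a function known to have derivatives of lower
    order; this is the induction step behind the closure properties below. *)
Lemma derivable_upto_step V n (f df : R -> V) :
  (forall t, U t -> is_derive t 1 f (df t)) -> derivable_upto n df ->
  derivable_upto n.+1 f.
Proof.
move=> fP dfs; apply/derivable_uptoS; split=> [t Ut|].
  by case: (fP t Ut).
apply: eq_on_derivable_upto dfs => t; rewrite inE => Ut.
by apply/esym/is_derive1_val; exact: fP.
Qed.

Lemma derivable_upto_cst V n (a : V) : derivable_upto n (fun=> a).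
Proof.
elim: n a => [|n IHn] a; first by move=> [|//] _ t _; exact: derivable_cst.
by apply: (derivable_upto_step (df := fun=> 0)); exact: IHn.
Qed.

Lemma derivable_upto_sum V n (I : finType) (f : I -> R -> V) :
  (forall i, derivable_upto n (f i)) ->
  derivable_upto n (fun t => \sum_i f i t).
Proof.
elim: n f => [|n IHn] f fs.
  move=> [|//] _ t Ut; suff [] : is_derive t 1 (fun s => \sum_i f i s)
      (\sum_i derive1 (f i) t) by [].
  by apply: is_derive_bigsum => i; apply: is_derive1; apply: derivable_upto1 Ut.
apply: derivable_upto_step => [t Ut|].
  by apply: is_derive_bigsum => i; apply: is_derive1; apply: derivable_upto1 Ut.
by apply: IHn => i; have /derivable_uptoS[] := fs i.
Qed.

Lemma derivable_upto_add V n (f g : R -> V) :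
  derivable_upto n f -> derivable_upto n g ->
  derivable_upto n (fun t => f t + g t).
Proof.
move=> fs gs; rewrite (_ : (fun _ => _) = fun t =>
    \sum_(b : bool) (if b then f else g) t).
  by apply: derivable_upto_sum => -[].
by apply/funext => t; rewrite big_bool.
Qed.

Lemma derivable_upto_scale V n (f : R -> R) (g : R -> V) :
  derivable_upto n f -> derivable_upto n g ->
  derivable_upto n (fun t => f t *: g t).
Proof.
elim: n f g => [|n IHn] f g fs gs.
  move=> [|//] _ t Ut; suff [] : is_derive t 1 (fun s => f s *: g s)
      (derive1 f t *: g t + f t *: derive1 g t) by [].
  apply: is_derive_scale; apply: is_derive1; first exact: derivable_upto1 fs t Ut.
  exact: derivable_upto1 gs t Ut.
apply: derivable_upto_step => [t Ut|].
  apply: is_derive_scale; apply: is_derive1; first exact: derivable_upto1 fs t Ut.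
  exact: derivable_upto1 gs t Ut.
have /derivable_uptoS[_ f's] := fs; have /derivable_uptoS[_ g's] := gs.
apply: derivable_upto_add; apply: IHn => //; exact: derivable_uptoW.
Qed.

Lemma smooth1_cst V (a : V) : smooth1_on U (fun=> a).
Proof. by apply/smooth1P => n; exact: derivable_upto_cst. Qed.

Lemma smooth1_sum V (I : finType) (f : I -> R -> V) :
  (forall i, smooth1_on U (f i)) -> smooth1_on U (fun t => \sum_i f i t).
Proof.
move=> fs; apply/smooth1P => n; apply: derivable_upto_sum => i.
by have /smooth1P := fs i; exact.
Qed.

Lemma smooth1_add V (f g : R -> V) :
  smooth1_on U f -> smooth1_on U g -> smooth1_on U (fun t => f t + g t).
Proof.
move=> /smooth1P fs /smooth1P gs; apply/smooth1P => n.
exact: derivable_upto_add.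
Qed.

Lemma smooth1_scale V (f : R -> R) (g : R -> V) :
  smooth1_on U f -> smooth1_on U g -> smooth1_on U (fun t => f t *: g t).
Proof.
move=> /smooth1P fs /smooth1P gs; apply/smooth1P => n.
exact: derivable_upto_scale.
Qed.

Lemma smooth1_opp V (f : R -> V) :
  smooth1_on U f -> smooth1_on U (fun t => - f t).
Proof.
move=> fs; rewrite (_ : (fun _ => _) = fun t => -1 *: f t).
  by apply: smooth1_scale => //; exact: smooth1_cst.
by apply/funext => t; rewrite scaleN1r.
Qed.

Lemma smooth1_sub V (f g : R -> V) :
  smooth1_on U f -> smooth1_on U g -> smooth1_on U (fun t => f t - g t).
Proof. by move=> fs gs; apply: smooth1_add => //; exact: smooth1_opp. Qed.

Lemma smooth1_derivable V (f : R -> V) (t : R) :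
  smooth1_on U f -> U t -> derivable f t 1.
Proof. by move=> /(_ 0); exact. Qed.

Lemma smooth1_derive1 V (f : R -> V) :
  smooth1_on U f -> smooth1_on U (derive1 f).
Proof. by move=> fs k t Ut; rewrite -derive1Sn; exact: fs. Qed.

Lemma is_derive_coord m (x : R -> 'rV[R]_m) t (k : 'I_m) :
  derivable x t 1 -> is_derive t 1 (fun s => x s 0 k) (derive1 x t 0 k).
Proof.
move=> xd; apply: DeriveDef; first exact: (derivable_mxP _ _ _).1.
by rewrite derive1E derive_mx// mxE.
Qed.

Lemma smooth1_coord m (x : R -> 'rV[R]_m) (k : 'I_m) :
  smooth1_on U x -> smooth1_on U (fun t => x t 0 k).
Proof.
move=> xs; apply/smooth1P => n; elim: n x xs => [|n IHn] x xs.
  move=> [|//] _ t Ut.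
  by have [] := is_derive_coord k (smooth1_derivable xs Ut).
apply: derivable_upto_step => [t Ut|].
  by apply: is_derive_coord; exact: smooth1_derivable Ut.
exact/IHn/smooth1_derive1.
Qed.

(** The chain rule expresses the derivative of [F \o x] by composites of the
    same shape, with the partial derivatives of [F] in place of [F]. *)
Lemma smooth1_comp m V (D : set 'rV[R]_m) (F : 'rV[R]_m -> V)
    (x : R -> 'rV[R]_m) :
  smooth_on D F -> smooth1_on U x -> (forall t, U t -> D (x t)) ->
  smooth1_on U (F \o x).
Proof.
move=> Fs xs xD; apply/smooth1P => n; elim: n F Fs => [|n IHn] F Fs.
  move=> [|//] _ t Ut.
  have [] // := is_derive1_comp (smooth1_derivable xs Ut) (Fs [::] _ (xD t Ut)).
apply: (derivable_upto_step (df := fun t =>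
    \sum_a derive1 x t 0 a *: ('D_(delta_mx 0 a) F \o x) t)) => [t Ut|].
  have Fd := Fs [::] _ (xD t Ut).
  have := is_derive1_comp (smooth1_derivable xs Ut) Fd.
  rewrite [derive1 x t in X in is_derive _ _ _ X]row_sum_delta deriveE//.
  rewrite linear_sum; under eq_bigr do rewrite linearZ -deriveE//.
  exact.
apply: derivable_upto_sum => a; apply: derivable_upto_scale.
  have /smooth1P := smooth1_coord (k := a) (smooth1_derive1 xs); exact.
exact/IHn/smooth_on_partial.
Qed.

End Smooth1.

(* Unfolding these while unifying two smoothness statements exposes limits and
   makes the comparison very slow. *)
Local Opaque smooth1_on derive1.

(** * Smooth families of linear maps *)

Lemma linear_row_sum (R : realType) (m : nat) (V : lmodType R)
    (L : 'rV[R]_m -> V) (v : 'rV[R]_m) :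
  linear L -> L v = \sum_a v 0 a *: L (delta_mx 0 a).
Proof.
move=> Llin; pose LM := GRing.isLinear.Build _ _ _ _ _ Llin.
pose LL : {linear _ -> _} := HB.pack L LM.
rewrite {1}[v]row_sum_delta -[L]/(LL : _ -> _) linear_sum.
by under eq_bigr do rewrite linearZ.
Qed.

Lemma linear_comp (R : realType) (U V W : lmodType R) (f : V -> W) (g : U -> V) :
  linear f -> linear g -> linear (fun u => f (g u)).
Proof. by move=> fl gl a u v; rewrite gl fl. Qed.

Lemma linear_add (R : realType) (V W : lmodType R) (f g : V -> W) :
  linear f -> linear g -> linear (fun u => f u + g u).
Proof. by move=> fl gl a u v; rewrite fl gl scalerDr addrACA. Qed.

Lemma linear_sub (R : realType) (V W : lmodType R) (f g : V -> W) :
  linear f -> linear g -> linear (fun u => f u - g u).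
Proof. by move=> fl gl a u v; rewrite fl gl opprD scalerBr addrACA. Qed.

Section LinearFamily.
Variables (R : realType) (U : set R) (U_open : open U) (m : nat).
Variables (V : normedModType R) (L : R -> 'rV[R]_m -> V).
Hypothesis L_linear : forall t, U t -> linear (L t).
Hypothesis L_smooth : forall u, smooth1_on U (L^~ u).

Let L_sum (A : R -> 'rV[R]_m) :
  {in U, (fun t => \sum_a A t 0 a *: L t (delta_mx 0 a)) =1 fun t => L t (A t)}.
Proof. by move=> t; rewrite inE => Ut; rewrite -linear_row_sum//; exact: L_linear. Qed.

Lemma smooth1_linear_family (A : R -> 'rV[R]_m) :
  smooth1_on U A -> smooth1_on U (fun t => L t (A t)).
Proof.
move=> As; apply: eq_on_smooth1 (L_sum A) _ => //.
apply: smooth1_sum => // a; apply: smooth1_scale => //.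
exact: smooth1_coord.
Qed.

(** Product rule: expanding [A] in the constant coordinate frame turns
    [L s (A s)] into a sum of products of scalar functions with the curves
    [L^~ e] for [e] in the frame. *)
Lemma derive1_linear_family (A : R -> 'rV[R]_m) t : smooth1_on U A -> U t ->
  derive1 (fun s => L s (A s)) t = derive1 (L^~ (A t)) t + L t (derive1 A t).
Proof.
move=> As Ut; have Ld u := is_derive1 (smooth1_derivable (@L_smooth u) Ut).
have /is_derive1_val LA : is_derive t 1
    (fun s => \sum_a A s 0 a *: L s (delta_mx 0 a))
    (\sum_a (derive1 A t 0 a *: L t (delta_mx 0 a) +
             A t 0 a *: derive1 (L^~ (delta_mx 0 a)) t)).
  apply: is_derive_bigsum => a; apply: is_derive_scale (Ld _).
  exact/is_derive_coord/smooth1_derivable/Ut.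
have /is_derive1_val LAt : is_derive t 1
    (fun s => \sum_a A t 0 a *: L s (delta_mx 0 a))
    (\sum_a (A t 0 a *: derive1 (L^~ (delta_mx 0 a)) t)).
  by apply: is_derive_bigsum => a; exact: is_deriveZ (Ld _).
have tU : t \in U by rewrite inE.
rewrite -(eq_on_derive1 U_open (L_sum A) tU) LA.
rewrite -(eq_on_derive1 U_open (L_sum (fun=> A t)) tU) LAt.
by rewrite big_split addrC -linear_row_sum//; exact: L_linear.
Qed.

(** Differentiating a linear family at frozen arguments keeps it linear, which is
    what makes the derivative of a tensor trilinear again. *)
Lemma linear_derive1_family t : U t -> linear (fun u => derive1 (L^~ u) t).
Proof.
move=> Ut a u v; have Ld w := is_derive1 (smooth1_derivable (@L_smooth w) Ut).
have tU : t \in U by rewrite inE.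
have Lauv : {in U, L^~ (a *: u + v) =1 fun s => a *: L s u + L s v}.
  by move=> s; rewrite inE => Us; exact: L_linear.
rewrite (eq_on_derive1 U_open Lauv tU).
exact: is_derive1_val.
Qed.

End LinearFamily.

(** * The Leibniz rule along a curve, in one chart *)

Section Leibniz.
Variables (R : realType) (U : set R) (U_open : open U) (m : nat).
Local Notation V := 'rV[R]_m.
Implicit Types (A B C : R -> V) (F : R -> V -> V -> V -> V).

(** [G t] is the linear part of covariant differentiation in a chart: along a
    curve [c], it is [u |-> Gamma (c' t) u]. *)
Variable G : R -> V -> V.
Hypothesis G_linear : forall t, U t -> linear (G t).
Hypothesis G_smooth : forall u, smooth1_on U (G^~ u).

Definition chart_covd A t := derive1 A t + G t (A t).

Definition chart_covd_tensor F t u v w :=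
  chart_covd (fun s => F s u v w) t
  - F t (chart_covd (fun=> u) t) v w
  - F t u (chart_covd (fun=> v) t) w
  - F t u v (chart_covd (fun=> w) t).

(** Smoothness is asked for constant arguments only; together with linearity it
    extends to smooth arguments, see [smooth1_tensor]. *)
Definition smooth_tensor F :=
  [/\ forall t v w, U t -> linear (fun u => F t u v w),
      forall t u w, U t -> linear (fun v => F t u v w),
      forall t u v, U t -> linear (F t u v) &
      forall u v w, smooth1_on U (fun t => F t u v w)].

Lemma eq_on_smooth_tensor F F' :
  (forall t u v w, U t -> F t u v w = F' t u v w) ->
  smooth_tensor F -> smooth_tensor F'.
Proof.
move=> FF' [Fl1 Fl2 Fl3 Fs]; split=> [t v w Ut|t u w Ut|t u v Ut|u v w].
- by move=> a x y; rewrite -!FF'//; exact: Fl1.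
- by move=> a x y; rewrite -!FF'//; exact: Fl2.
- by move=> a x y; rewrite -!FF'//; exact: Fl3.
by apply: (eq_on_smooth1 U_open _ (Fs u v w)) => t; rewrite inE; exact: FF'.
Qed.

Lemma chart_covd_cst u t : chart_covd (fun=> u) t = G t u.
Proof. by rewrite /chart_covd derive1_cst add0r. Qed.

Lemma chart_covd_tensorE F t u v w : chart_covd_tensor F t u v w =
  derive1 (fun s => F s u v w) t + G t (F t u v w)
  - F t (G t u) v w - F t u (G t v) w - F t u v (G t w).
Proof. by rewrite /chart_covd_tensor !chart_covd_cst. Qed.

Lemma smooth1_chart_covd A : smooth1_on U A -> smooth1_on U (chart_covd A).
Proof.
move=> As; apply: (smooth1_add U_open (smooth1_derive1 As)).
exact: (smooth1_linear_family U_open G_linear (@G_smooth) As).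
Qed.

Lemma smooth1_iter_chart_covd n A :
  smooth1_on U A -> smooth1_on U (iter n chart_covd A).
Proof. by move=> As; elim: n => [//|n IHn]; exact: smooth1_chart_covd. Qed.

Lemma eq_on_chart_covd A B : {in U, A =1 B} ->
  {in U, chart_covd A =1 chart_covd B}.
Proof. by move=> AB t tU; rewrite /chart_covd AB// (eq_on_derive1 U_open AB). Qed.

Lemma chart_covd_sum (I : finType) (k : I -> R) (A : I -> R -> V) t :
  (forall i, smooth1_on U (A i)) -> U t ->
  chart_covd (fun s => \sum_i k i *: A i s) t = \sum_i k i *: chart_covd (A i) t.
Proof.
move=> As Ut; have /is_derive1_val dA : is_derive t 1
    (fun s => \sum_i k i *: A i s) (\sum_i k i *: derive1 (A i) t).
  apply: is_derive_bigsum => i.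
  exact: is_deriveZ (is_derive1 (smooth1_derivable (As i) Ut)).
pose GM := GRing.isLinear.Build _ _ _ _ _ (G_linear Ut).
pose GL : {linear _ -> _} := HB.pack (G t) GM.
rewrite /chart_covd dA -[G t]/(GL : _ -> _) linear_sum -big_split.
by apply: eq_bigr => i _; rewrite linearZ scalerDr.
Qed.

(** Each slot in turn is treated as a smooth family of linear maps, the slots
    on its left having already been replaced by fields. *)
Lemma smooth1_tensor F A B C : smooth_tensor F ->
  smooth1_on U A -> smooth1_on U B -> smooth1_on U C ->
  smooth1_on U (fun t => F t (A t) (B t) (C t)).
Proof.
move=> [Fl1 Fl2 Fl3 Fs] As Bs Cs.
have A_smooth v w : smooth1_on U (fun t => F t (A t) v w) :=
  smooth1_linear_family U_open
  (L := fun t u => F t u v w) (Fl1 ^~ v ^~ w) (Fs ^~ v ^~ w) As.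
have AB_smooth w : smooth1_on U (fun t => F t (A t) (B t) w) :=
  smooth1_linear_family U_open
  (L := fun t v => F t (A t) v w) (fun t => Fl2 t (A t) w) (A_smooth ^~ w) Bs.
exact: (smooth1_linear_family U_open
  (L := fun t w => F t (A t) (B t) w) (fun t => Fl3 t (A t) (B t)) AB_smooth Cs).
Qed.

Lemma derive1_tensor F A B C t : smooth_tensor F ->
  smooth1_on U A -> smooth1_on U B -> smooth1_on U C -> U t ->
  derive1 (fun s => F s (A s) (B s) (C s)) t =
  derive1 (fun s => F s (A t) (B t) (C t)) t + F t (derive1 A t) (B t) (C t)
  + F t (A t) (derive1 B t) (C t) + F t (A t) (B t) (derive1 C t).
Proof.
move=> FT As Bs Cs Ut; have [Fl1 Fl2 Fl3 Fs] := FT.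
have cs (u : V) : smooth1_on U (fun=> u) by exact: smooth1_cst.
rewrite (derive1_linear_family U_open (L := fun t w => F t (A t) (B t) w)
  (fun t => Fl3 t (A t) (B t)) (fun w => smooth1_tensor FT As Bs (cs w)) Cs Ut).
rewrite (derive1_linear_family U_open (L := fun s v => F s (A s) v (C t))
  (fun s => Fl2 s (A s) (C t)) (fun v => smooth1_tensor FT As (cs v) (cs _)) Bs Ut).
by rewrite (derive1_linear_family U_open (L := fun s u => F s u (B t) (C t))
  (fun s => Fl1 s (B t) (C t)) (fun u => Fs u _ _) As Ut).
Qed.

(** The covariant derivative of [F] is defined with constant extensions of the
    arguments; trilinearity makes up for the derivatives of actual fields. *)
Lemma chart_covd_leibniz F A B C t : smooth_tensor F ->
  smooth1_on U A -> smooth1_on U B -> smooth1_on U C -> U t ->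
  chart_covd (fun s => F s (A s) (B s) (C s)) t =
  chart_covd_tensor F t (A t) (B t) (C t) + F t (chart_covd A t) (B t) (C t)
  + F t (A t) (chart_covd B t) (C t) + F t (A t) (B t) (chart_covd C t).
Proof.
move=> FT As Bs Cs Ut; have [Fl1 Fl2 Fl3 Fs] := FT.
have Fadd1 u u' v w : F t (u + u') v w = F t u v w + F t u' v w.
  by have := Fl1 t v w Ut 1 u u'; rewrite !scale1r.
have Fadd2 u v v' w : F t u (v + v') w = F t u v w + F t u v' w.
  by have := Fl2 t u w Ut 1 v v'; rewrite !scale1r.
have Fadd3 u v w w' : F t u v (w + w') = F t u v w + F t u v w'.
  by have := Fl3 t u v Ut 1 w w'; rewrite !scale1r.
rewrite chart_covd_tensorE /chart_covd (derive1_tensor FT As Bs Cs Ut).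
rewrite Fadd1 Fadd2 Fadd3; apply/rowP => j; rewrite !mxE; ring.
Qed.

Lemma smooth_chart_covd_tensor F :
  smooth_tensor F -> smooth_tensor (chart_covd_tensor F).
Proof.
move=> FT; have [Fl1 Fl2 Fl3 Fs] := FT.
have cs (u : V) : smooth1_on U (fun=> u) by exact: smooth1_cst.
split=> [t v w Ut|t u w Ut|t u v Ut|u v w].
- have lin : linear (fun u => derive1 (fun s => F s u v w) t + G t (F t u v w)
      - F t (G t u) v w - F t u (G t v) w - F t u v (G t w)).
    apply: linear_sub (Fl1 t v _ Ut).
    apply: linear_sub (Fl1 t _ w Ut).
    apply: linear_sub (linear_comp (Fl1 t v w Ut) (G_linear Ut)).
    apply: linear_add (linear_comp (G_linear Ut) (Fl1 t v w Ut)).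
    exact: (linear_derive1_family U_open (L := fun s u => F s u v w)
      (fun s => Fl1 s v w) (fun u => Fs u v w) Ut).
  by move=> a x y; rewrite !chart_covd_tensorE lin.
- have lin : linear (fun v => derive1 (fun s => F s u v w) t + G t (F t u v w)
      - F t (G t u) v w - F t u (G t v) w - F t u v (G t w)).
    apply: linear_sub (Fl2 t u _ Ut).
    apply: linear_sub (linear_comp (Fl2 t u w Ut) (G_linear Ut)).
    apply: linear_sub (Fl2 t _ w Ut).
    apply: linear_add (linear_comp (G_linear Ut) (Fl2 t u w Ut)).
    exact: (linear_derive1_family U_open (L := fun s v => F s u v w)
      (fun s => Fl2 s u w) (fun v => Fs u v w) Ut).
  by move=> a x y; rewrite !chart_covd_tensorE lin.
- have lin : linear (fun w => derive1 (fun s => F s u v w) t + G t (F t u v w)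
      - F t (G t u) v w - F t u (G t v) w - F t u v (G t w)).
    apply: linear_sub (linear_comp (Fl3 t u v Ut) (G_linear Ut)).
    apply: linear_sub (Fl3 t u _ Ut).
    apply: linear_sub (Fl3 t _ v Ut).
    apply: linear_add (linear_comp (G_linear Ut) (Fl3 t u v Ut)).
    exact: (linear_derive1_family U_open (L := fun s w => F s u v w)
      (fun s => Fl3 s u v) (fun w => Fs u v w) Ut).
  by move=> a x y; rewrite !chart_covd_tensorE lin.
have Gs (x : V) : smooth1_on U (fun t => G t x) := @G_smooth x.
rewrite (_ : (fun t => _) = fun t =>
    derive1 (fun s => F s u v w) t + G t (F t u v w)
    - F t (G t u) v w - F t u (G t v) w - F t u v (G t w)); last first.
  by apply/funext => t; exact: chart_covd_tensorE.
apply: (smooth1_sub U_open _ (smooth1_tensor FT (cs u) (cs v) (Gs w))).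
apply: (smooth1_sub U_open _ (smooth1_tensor FT (cs u) (Gs v) (cs w))).
apply: (smooth1_sub U_open _ (smooth1_tensor FT (Gs u) (cs v) (cs w))).
apply: (smooth1_add U_open (smooth1_derive1 (Fs u v w))).
exact: (smooth1_linear_family U_open G_linear (@G_smooth) (Fs u v w)).
Qed.

Lemma smooth_iter_chart_covd_tensor n F :
  smooth_tensor F -> smooth_tensor (iter n chart_covd_tensor F).
Proof. by move=> FT; elim: n => [//|n IHn]; exact: smooth_chart_covd_tensor. Qed.

(** In the application, [a j i] has [j] derivatives on the tensor and [i] on the
    field, so that the left-hand side is what one more derivation produces. *)
Lemma sum_pascal (W : lmodType R) n (a : nat -> nat -> W) :
  \sum_(i < n.+1) 'C(n, i)%:R *: (a (n - i).+1 i + a (n - i)%N i.+1) =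
  \sum_(i < n.+2) 'C(n.+1, i)%:R *: a (n.+1 - i)%N i.
Proof.
under eq_bigr do rewrite scalerDr.
rewrite big_split [RHS]big_ord_recl /=.
under [X in _ = _ + X]eq_bigr => i _.
  rewrite /bump add1n binS natrD scalerDl subSS; over.
rewrite big_split /= addrA; congr (_ + _).
rewrite [X in _ = _ + X]big_ord_recr /= [in X in _ + X](@bin_small n n.+1)// scale0r addr0.
rewrite [LHS]big_ord_recl /= !bin0 subn0; congr (_ + _).
by apply: eq_bigr => i _; rewrite /bump add1n subnSK.
Qed.

(** Since [B] is parallel, a derivation of [F (A, B, B)] falls on [F] or on [A]
    only, as for a product of two factors. *)
Lemma iter_chart_covd_leibniz F A B n : smooth_tensor F ->
  smooth1_on U A -> smooth1_on U B -> {in U, chart_covd B =1 fun=> 0} ->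
  {in U, iter n chart_covd (fun s => F s (A s) (B s) (B s)) =1 fun t =>
    \sum_(i < n.+1) 'C(n, i)%:R *:
      iter (n - i) chart_covd_tensor F t (iter i chart_covd A t) (B t) (B t)}.
Proof.
move=> FT As Bs B0; elim: n => [|n IHn] t tU.
  by rewrite big_ord1 scale1r.
have Ut : U t by rewrite inE in tU.
have Ais i : smooth1_on U (iter i chart_covd A).
  exact: (smooth1_iter_chart_covd As).
have FnT k : smooth_tensor (iter k chart_covd_tensor F).
  exact: smooth_iter_chart_covd_tensor.
rewrite iterS (eq_on_chart_covd IHn tU).
rewrite (chart_covd_sum (A := fun (i : 'I_n.+1) s =>
    iter (n - i) chart_covd_tensor F s (iter i chart_covd A s) (B s) (B s))
  _ (fun i => smooth1_tensor (FnT _) (Ais i) Bs Bs) Ut).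
rewrite -(sum_pascal n (fun j i =>
  iter j chart_covd_tensor F t (iter i chart_covd A t) (B t) (B t))).
apply: eq_bigr => i _; congr (_ *: _).
rewrite (chart_covd_leibniz (FnT _) (Ais i) Bs Bs Ut) (B0 t tU).
have [_ Fl2 Fl3 _] := FnT (n - i)%N.
have zero (L : V -> V) : linear L -> L 0 = 0.
  by move=> /(_ (-1) 0 0); rewrite !scaleN1r oppr0 addr0 addNr.
by rewrite (zero _ (Fl2 _ _ _ Ut)) (zero _ (Fl3 _ _ _ Ut)) !addr0.
Qed.

End Leibniz.

(** * Christoffel symbols and curvature in a chart *)

Section ChartCurvature.
Variables (R : realType) (m : nat) (M : analytic_manifold R m).
Implicit Types (G : coefs M) (N : connection M) (i : chart M) (p : M).
Implicit Types (x u v w : 'rV[R]_m).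

Lemma linear_coefs_actl G i x w : linear (fun u => coefs_act G i x u w).
Proof.
move=> k u u'; rewrite /coefs_act scaler_sumr -big_split; apply: eq_bigr => a _.
rewrite scaler_sumr -big_split; apply: eq_bigr => b _ /=.
by rewrite !mxE mulrDl -mulrA scalerDl scalerA.
Qed.

Lemma linear_coefs_actr G i x u : linear (coefs_act G i x u).
Proof.
move=> k w w'; rewrite /coefs_act scaler_sumr -big_split; apply: eq_bigr => a _.
rewrite scaler_sumr -big_split; apply: eq_bigr => b _ /=.
by rewrite !mxE mulrDr mulrCA scalerDl scalerA.
Qed.

Lemma coefs_act0l G i x w : coefs_act G i x 0 w = 0.
Proof.
by rewrite /coefs_act big1// => a _; rewrite big1// => b _; rewrite mxE mul0r scale0r.
Qed.

Lemma smooth1_coefs_act (U : set R) (U_open : open U) G i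
    (x A B : R -> 'rV[R]_m) :
  (forall a b, smooth1_on U (fun t => G i (x t) a b)) ->
  smooth1_on U A -> smooth1_on U B ->
  smooth1_on U (fun t => coefs_act G i (x t) (A t) (B t)).
Proof.
move=> Gs As Bs; apply: (smooth1_sum U_open) => a.
apply: (smooth1_sum U_open) => b.
apply: (smooth1_scale U_open) (Gs a b).
have Aa := smooth1_coord U_open (k := a) As.
have Bb := smooth1_coord U_open (k := b) Bs.
exact: (smooth1_scale U_open Aa Bb).
Qed.

(** Differentiating the coefficients in a fixed direction gives coefficients of
    the same type, so that the facts about [coefs_act] apply to them. *)
Definition dcoefs G u : coefs M := fun i x a b => 'D_u (fun y => G i y a b) x.

Lemma codom_coord i p : dom i p -> Defs.codom i (Defs.coord i p).
Proof. by move=> ip; exists p. Qed.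

Lemma differentiable_christoffel N i p a b : dom i p ->
  differentiable (fun y => christoffel N i y a b) (Defs.coord i p).
Proof.
by move=> ip; exact: (christoffel_smooth N a b [::] (codom_coord ip)).
Qed.

Lemma derive_coefs_act N i p u v w : dom i p ->
  'D_u (fun y => coefs_act N i y v w) (Defs.coord i p) =
  coefs_act (dcoefs N u) i (Defs.coord i p) v w.
Proof.
move=> ip; suff [_ ->] : is_derive (Defs.coord i p) u
  (fun y => coefs_act N i y v w) (coefs_act (dcoefs N u) i (Defs.coord i p) v w) by [].
apply: is_derive_bigsum => a; apply: is_derive_bigsum => b.
apply: is_deriveZ; apply: derivableP; apply: diff_derivable.
exact: differentiable_christoffel.
Qed.

Lemma linear_dcoefs N i p v w : dom i p ->
  linear (fun u => coefs_act (dcoefs N u) i (Defs.coord i p) v w).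
Proof.
move=> ip k u u'; rewrite /coefs_act scaler_sumr -big_split.
apply: eq_bigr => a _; rewrite scaler_sumr -big_split; apply: eq_bigr => b _ /=.
have Nd := differentiable_christoffel N a b ip.
by rewrite /dcoefs (derive_linear_dir Nd) scalerDr !scalerA [k * _]mulrC.
Qed.

(** The classical expression of the curvature in terms of Christoffel symbols
    and their first partial derivatives. *)
Definition chart_curv N i x u v w : 'rV[R]_m :=
  coefs_act (dcoefs N u) i x v w - coefs_act (dcoefs N v) i x u w
  + (coefs_act N i x u (coefs_act N i x v w)
     - coefs_act N i x v (coefs_act N i x u w)).

(** Fields with constant components have zero bracket in the chart, and their
    covariant derivatives reduce to the Christoffel terms, so that a second
    covariant derivative only differentiates the symbols. *)
Lemma curv_atE N i p (u v w : tvec M) : dom i p ->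
  curv_at N p u v w i = chart_curv N i (Defs.coord i p) (u i) (v i) (w i).
Proof.
move=> ip.
have nabla_cst (a b : tvec M) (q : M) :
    nabla N (fun=> a) (fun=> b) q i = coefs_act N i (Defs.coord i q) (a i) (b i).
  by rewrite /nabla /local_rep derive_cst add0r.
have nabla2 (a b d : tvec M) :
    nabla N (fun=> a) (nabla N (fun=> b) (fun=> d)) p i =
    coefs_act (dcoefs N (a i)) i (Defs.coord i p) (b i) (d i) +
    coefs_act N i (Defs.coord i p) (a i) (coefs_act N i (Defs.coord i p) (b i) (d i)).
  rewrite {1}/nabla nabla_cst; congr (_ + _).
  rewrite -derive_coefs_act//; apply: near_eq_derive.
  have codom_nbhs : nbhs (Defs.coord i p) (Defs.codom i).
    by apply: open_nbhs_nbhs; split; [exact: codom_open|exact: codom_coord].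
  apply: filterS codom_nbhs => _ [q iq <-].
  by rewrite /local_rep nabla_cst coordK.
have bracket0 : bracket (fun=> u) (fun=> v) p i = 0.
  by rewrite /bracket /local_rep !derive_cst subrr.
transitivity (nabla N (fun=> u) (nabla N (fun=> v) (fun=> w)) p i
  - nabla N (fun=> v) (nabla N (fun=> u) (fun=> w)) p i
  - nabla N (bracket (fun=> u) (fun=> v)) (fun=> w) p i); first by [].
rewrite !nabla2 {1}/nabla bracket0 coefs_act0l derive0 addr0 subr0.
by rewrite /chart_curv opprD addrACA.
Qed.

(** Unlike [curv_atE], this does not require [p] to lie in the domain of [i], so
    it allows the comparison of whole curves in the chart, without regard to
    where they leave its domain. *)
Lemma curv_at_component N i p (u v w : tvec M) :
  curv_at N p u v w i = curv_at N p (fun=> u i) (fun=> v i) (fun=> w i) i.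
Proof. by []. Qed.

Section AlongCurve.
Variables (N : connection M) (i : chart M) (U : set R) (c : R -> M).
Hypothesis U_open : open U.
Hypothesis c_dom : forall t, U t -> dom i (c t).
Let x t := Defs.coord i (c t).
Hypothesis x_smooth : smooth1_on U x.

Lemma smooth1_christoffel a b : smooth1_on U (fun t => christoffel N i (x t) a b).
Proof.
apply: (smooth1_comp U_open (christoffel_smooth N a b) x_smooth) => t Ut.
exact/codom_coord/c_dom.
Qed.

Lemma smooth1_dcoefs u a b : smooth1_on U (fun t => dcoefs N u i (x t) a b).
Proof.
apply: (@eq_on_smooth1 _ _ U_open _ (fun t =>
  \sum_k u 0 k *: 'D_(delta_mx 0 k) (fun y => christoffel N i y a b) (x t))).
  move=> t; rewrite inE => Ut; rewrite -linear_row_sum//.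
  exact/derive_linear_dir/differentiable_christoffel/c_dom.
apply: (smooth1_sum U_open) => k.
have uk : smooth1_on U (fun=> u 0 k) by exact: smooth1_cst.
apply: (smooth1_scale U_open uk).
have Nk := smooth_on_partial k (christoffel_smooth N (i := i) a b).
apply: (smooth1_comp U_open Nk x_smooth) => t Ut.
exact/codom_coord/c_dom.
Qed.

Lemma smooth_tensor_chart_curv :
  smooth_tensor U (fun t => chart_curv N i (x t)).
Proof.
have cs (u : 'rV[R]_m) : smooth1_on U (fun=> u) by exact: smooth1_cst.
split=> [t v w Ut|t u w Ut|t u v Ut|u v w].
- apply: linear_add.
    by apply: linear_sub; [exact/linear_dcoefs/c_dom|exact: linear_coefs_actl].
  apply: linear_sub; first exact: linear_coefs_actl.
  exact: linear_comp (linear_coefs_actr _ _ _ _) (linear_coefs_actl _ _ _ _).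
- apply: linear_add.
    by apply: linear_sub; [exact: linear_coefs_actl|exact/linear_dcoefs/c_dom].
  apply: linear_sub; last exact: linear_coefs_actl.
  exact: linear_comp (linear_coefs_actr _ _ _ _) (linear_coefs_actl _ _ _ _).
- apply: linear_add.
    by apply: linear_sub; exact: linear_coefs_actr.
  apply: linear_sub;
    exact: linear_comp (linear_coefs_actr _ _ _ _) (linear_coefs_actr _ _ _ _).
have act_smooth (A B : R -> 'rV[R]_m) : smooth1_on U A -> smooth1_on U B ->
    smooth1_on U (fun t => coefs_act N i (x t) (A t) (B t)).
  exact: (smooth1_coefs_act U_open smooth1_christoffel).
have dact_smooth (a b d : 'rV[R]_m) :
    smooth1_on U (fun t => coefs_act (dcoefs N a) i (x t) b d).
  apply: (smooth1_coefs_act U_open (A := fun=> b) (B := fun=> d) _ (cs b) (cs d)).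
  exact: smooth1_dcoefs.
have act2_smooth (a b d : 'rV[R]_m) :
    smooth1_on U (fun t => coefs_act N i (x t) a (coefs_act N i (x t) b d)).
  exact: (act_smooth _ _ (cs a) (act_smooth _ _ (cs b) (cs d))).
apply: (smooth1_add U_open).
  exact: (smooth1_sub U_open (dact_smooth u v w) (dact_smooth v u w)).
exact: (smooth1_sub U_open (act2_smooth u v w) (act2_smooth v u w)).
Qed.

End AlongCurve.
End ChartCurvature.

(** * Reduction to a chart *)

Section Reduction.
Variables (R : realType) (m : nat) (M : analytic_manifold R m).
Variables (N : connection M) (c : R -> M) (i : chart M).

(** The zeroth-order part of [covd N c], in components in the chart [i]. *)
Definition connection_form t u :=
  coefs_act N i (Defs.coord i (c t)) (velocity c t i) u.

(** [covd] computes each component from the components in the same chart, by a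
    formula that makes sense at all times; the identification below therefore
    holds for the iterates without any condition on [t]. *)
Lemma iter_covd_chart n (X : R -> tvec M) t :
  iter n (covd N c) X t i =
  iter n (chart_covd connection_form) (fun s => X s i) t.
Proof.
elim: n t => [//|n IHn] t; rewrite !iterS /chart_covd.
have <- : (fun s => iter n (covd N c) X s i) =
    iter n (chart_covd connection_form) (fun s => X s i) by exact/funext.
by [].
Qed.

Lemma iter_covd_tensor_chart n (T : tensor13 M)
    (F : R -> 'rV[R]_m -> 'rV[R]_m -> 'rV[R]_m -> 'rV[R]_m) t (u v w : tvec M) :
  (forall s (a b d : tvec M), T s a b d i = F s (a i) (b i) (d i)) ->
  iter n (covd_tensor N c) T t u v w i =
  iter n (chart_covd_tensor connection_form) F t (u i) (v i) (w i).
Proof.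
move=> TF; elim: n t u v w => [|n IHn] t u v w; first exact: TF.
rewrite !iterS; set T' := iter n _ T; set F' := iter n _ F.
have T'F' s (a b d : tvec M) : T' s a b d i = F' s (a i) (b i) (d i).
  exact: IHn.
transitivity (covd N c (fun s => T' s u v w) t i
    - T' t (covd N c (fun=> u) t) v w i - T' t u (covd N c (fun=> v) t) w i
    - T' t u v (covd N c (fun=> w) t) i); first by [].
have -> : covd N c (fun s => T' s u v w) t i =
    chart_covd connection_form (fun s => F' s (u i) (v i) (w i)) t.
  rewrite -[LHS]/(chart_covd connection_form
    (fun s => T' s u v w i) t).
  by congr (chart_covd _ _ t); apply/funext => s; exact: T'F'.
by rewrite !T'F'.
Qed.

End Reduction.

Theorem theorem1p3 (R : realType) (m : nat) (M : analytic_manifold R m)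
  (M_connected : connected [set: M])
  (g : metric M) (N : connection M) (N_LC : levi_civita g N)
  (J : set R) (J_open : open J) (J_itv : is_interval J) (J0 : J 0)
  (c : R -> M) (c_geodesic : geodesic N J c)
  (c_unit : forall i, dom i (c 0) ->
     inner g i (c 0) (velocity c 0) (velocity c 0) = 1)
  (X : R -> tvec M) (X_field : is_vfield_along J c X)
  (n : nat) (n_ge1 : (1 <= n)%N) (t : R) (Jt : J t) :
  iter n (covd N c)
    (fun s => curv_at N (c s) (X s) (velocity c s) (velocity c s)) t
  =_[c t]
  \sum_(0 <= i < n.+1)
     'C(n, i)%:R *: jacobi_op N c (n - i) t (iter i (covd N c) X t).
Proof.
move=> i ict.
have [[c_cont c_smooth] c_geo] := c_geodesic.
have [_ X_smooth] := X_field.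
pose U := J `&` c @^-1` dom i.
have U_open : open U.
  rewrite openE => s [Js ics]; apply: filterI.
    exact: open_nbhs_nbhs.
  by apply: c_cont => //; apply: open_nbhs_nbhs; split=> //; exact: dom_open.
have c_dom s : U s -> dom i (c s) by case.
have x_smooth : smooth1_on U (fun s => Defs.coord i (c s)) by exact: c_smooth.
have Xi_smooth : smooth1_on U (fun s => X s i) by exact: X_smooth.
pose B s := velocity c s i.
have B_smooth : smooth1_on U B by exact: (smooth1_derive1 x_smooth).
pose G := connection_form N c i.
have G_linear s : U s -> linear (G s).
  by move=> _; exact: linear_coefs_actr.
have G_smooth u : smooth1_on U (G^~ u).
  have us : smooth1_on U (fun=> u) by exact: smooth1_cst.
  apply: (smooth1_coefs_act U_open _ B_smooth us) => a b.
  exact: smooth1_christoffel.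
have B_parallel : {in U, chart_covd G B =1 fun=> 0}.
  by move=> s; rewrite inE => -[Js ics]; exact: (c_geo s Js i ics).
(* [F] is defined through [curv_at] rather than [chart_curv], which agrees with it
   only over [U]: the reduction of tensors to a chart wants an equality at all
   times. *)
pose F s u v w := curv_at N (c s) (fun=> u) (fun=> v) (fun=> w) i.
have F_tensor : smooth_tensor U F.
  apply: (eq_on_smooth_tensor U_open _
    (smooth_tensor_chart_curv N U_open c_dom x_smooth)) => s u v w Us.
  by rewrite /F curv_atE//; exact: c_dom.
have tU : t \in U by rewrite inE.
rewrite iter_covd_chart.
have -> : (fun s => curv_at N (c s) (X s) (velocity c s) (velocity c s) i) =
    (fun s => F s (X s i) (B s) (B s)).
  by apply/funext => s; exact: curv_at_component.
rewrite (iter_chart_covd_leibniz U_open G_linear G_smooth n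
  F_tensor Xi_smooth B_smooth B_parallel tU).
rewrite big_mkord fct_sumE; apply: eq_bigr => k _.
rewrite -iter_covd_chart.
by rewrite -[RHS]/('C(n, k)%:R *: jacobi_op N c (n - k) t (iter k (covd N c) X t) i)
  /jacobi_op (iter_covd_tensor_chart N c _ _ _ _ _ (F := F)).
Qed.
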